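(* $\mathfrak e^{\mathrm{const}}(2)\le\operatorname{non}(M_{\mathcal{ED}})$ and $\mathfrak v^{\mathrm{const}}(2)\ge\operatorname{cov}(M_{\mathcal{ED}})$.
   Context: $\mathcal{ED}=\{A\subseteq\omega\times\omega:\exists k<\omega\,\forall^\infty n<\omega\ |\{m:\langle n,m\rangle\in A\}|\le k\}$. For an ideal $\mathscr I$ on a countable set $X$, $M_{\mathscr I}$ is the $\sigma$-ideal on $X^\omega$ generated by the sets $M_\phi=\{x\in X^\omega:\forall^\infty n\ x(n)\in\phi(x\upharpoonright n)\}$, $\phi\colon X^{<\omega}\to\mathscr I$; $\operatorname{non}(M_{\mathscr I})$ is the least size of a subset of $X^\omega$ not in $M_{\mathscr I}$, and $\operatorname{cov}(M_{\mathscr I})$ is the least size of a subfamily of $M_{\mathscr I}$ covering $X^\omega$. A predictor is a function $\pi\colon\omega^{<\omega}\to\omega$; $\mathrm{Pred}$ is the set of predictors. For $f\in\omega^\omega$, $f\sqsubset^{\mathrm{pc},2}\pi$ means: for all but finitely many $i<\omega$ there is $j\in[i,i+2)$ with $f(j)=\pi(f\upharpoonright j)$. $\mathfrak e^{\mathrm{const}}(2)=\min\{|F|:F\subseteq\omega^\omega,\ \forall\pi\in\mathrm{Pred}\,\exists f\in F\ \neg(f\sqsubset^{\mathrm{pc},2}\pi)\}$ and $\mathfrak v^{\mathrm{const}}(2)=\min\{|\Pi|:\Pi\subseteq\mathrm{Pred},\ \forall f\in\omega^\omega\,\exists\pi\in\Pi\ f\sqsubset^{\mathrm{pc},2}\pi\}$.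 *)

(* Defs.v *)
From HB Require Import structures.
From mathcomp Require Import all_boot.
From mathcomp Require Import all_classical.

Set Implicit Arguments.
Unset Strict Implicit.
Unset Printing Implicit Defensive.

Local Open Scope classical_set_scope.
Local Open Scope card_scope.

Definition least_size_in (T : Type) (C : set (set T)) : set (set T) :=
  [set A | C A /\ forall B, C B -> A #<= B].

(* Cardinals are handled through sets of that cardinality, compared with [#<=]:
   [least_size C] is a member of [C] of minimum cardinality. Such a member
   exists as soon as [C] is nonempty (lemma [least_sizeP]); [setT] is a dummy
   value for empty [C]. *)
Definition least_size (T : Type) (C : set (set T)) : set T :=
  xget setT (least_size_in C).

(* Existence of a minimum: in the product of the members of [C], take a maximal
   set [Y] of functions on which every projection is injective; by maximality
   some projection maps [Y] onto a member of [C]. *)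
Lemma least_size_ex (T : Type) (C : set (set T)) :
  C !=set0 -> least_size_in C !=set0.
Proof.
move=> [A0 CA0].
pose I := {B : set T | C B}.
pose P (Y : set (I -> T)) :=
  (forall f, Y f -> forall i, sval i (f i)) /\
  (forall f g i, Y f -> Y g -> f i = g i -> f = g).
have [|Y [[Yin Yinj] Ymax]] := @Zorn_bigcup (I -> T) P.
  move=> F FP totF; split.
    by move=> f [Z FZ Zf] i; have [+ _] := FP _ FZ; apply.
  move=> f g i [Z FZ Zf] [W FW Wg] fg.
  have [ZW|WZ] := totF _ _ FZ FW.
    by have [_ inj] := FP _ FW; apply: (inj f g i) => //; exact: ZW.
  by have [_ inj] := FP _ FZ; apply: (inj f g i) => //; exact: WZ.
have [[i iY]|noi] := pselect (exists i : I, sval i `<=` [set f i | f in Y]).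
  exists (sval i); split; first exact: (svalP i).
  move=> B CB.
  apply: (@card_le_trans _ _ _ Y).
    exact: card_le_trans (subset_card_le iY) (card_image_le _ _).
  pose j : I := exist _ B CB.
  suff [f] : $|{injfun Y >-> B}| by exact: inj_card_le f.
  apply/injfunPex; exists (fun f => f j); first by move=> f /Yin /(_ j).
  by move=> f g /set_mem Yf /set_mem Yg; exact: Yinj.
have {}noi i : exists x, sval i x /\ ~ [set f i | f in Y] x.
  apply: contra_notP noi => nox; exists i => x ix.
  by apply: contrapT => xY; apply: nox; exists x.
have /choice[h hP] := noi.
have hY f i : Y f -> f i = h i -> False.
  by move=> Yf fh; have [_] := hP i; apply; exists f.
exfalso; apply: (Ymax (Y `|` [set h])).
  split; first by move=> f; left.
  move=> /(_ h (or_intror erefl)) Yh.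
  by have [_] := hP (exist _ A0 CA0); apply; exists h.
split.
  by move=> f [/Yin//|-> i]; have [] := hP i.
move=> f g i [Yf|->] [Yg|->] //; first exact: Yinj.
  by move=> /hY; case/(_ Yf).
by move=> /esym /hY; case/(_ Yg).
Qed.

Lemma least_sizeP (T : Type) (C : set (set T)) :
  C !=set0 -> C (least_size C) /\ forall B, C B -> least_size C #<= B.
Proof. by move=> /least_size_ex; exact: xgetPex. Qed.

Definition sigma_ideal (Y : Type) (J : set (set Y)) : Prop :=
  [/\ J set0,
      forall A B, A `<=` B -> J B -> J A
    & forall A : nat -> set Y, (forall n, J (A n)) -> J (\bigcup_n A n)].

(* [x] restricted to [n] is [mkseq x n] = [:: x 0; ...; x n.-1]. *)
Definition M_gen (X : Type) (phi : seq X -> set X) : set (nat -> X) :=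
  [set x | \forall n \near \oo, phi (mkseq x n) (x n)].

Definition M_ideal (X : Type) (I : set (set X)) : set (set (nat -> X)) :=
  smallest (@sigma_ideal (nat -> X))
    [set M_gen phi | phi in [set phi | forall s, I (phi s)]].

Definition non_M (X : Type) (I : set (set X)) : set (nat -> X) :=
  least_size [set F | ~ M_ideal I F].

Definition cov_M (X : Type) (I : set (set X)) : set (set (nat -> X)) :=
  least_size [set G | G `<=` M_ideal I /\ \bigcup_(A in G) A = setT].

Definition ED : set (set (nat * nat)) :=
  [set A | exists k, \forall n \near \oo, [set m | A (n, m)] #<= `I_k].

Definition predictor := seq nat -> nat.

Definition pc_predicts (k : nat) (f : nat -> nat) (pi : predictor) : Prop :=
  \forall i \near \oo, exists j, i <= j < i + k /\ f j = pi (mkseq f j).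

Definition e_const (k : nat) : set (nat -> nat) :=
  least_size [set F : set (nat -> nat) |
    forall pi, exists f, F f /\ ~ pc_predicts k f pi].

Definition v_const (k : nat) : set predictor :=
  least_size [set P : set predictor |
    forall f, exists pi, P pi /\ pc_predicts k f pi].

(* Main.v *)
Require Import Defs.
From mathcomp Require Import all_boot.
From mathcomp Require Import all_classical.

(** Interleave [x : nat -> nat * nat] into [f : nat -> nat] with
[(f (2n), f (2n+1)) = x n]. If [pi] predicts [f] in the constant sense for
blocks of length 2, then for almost all [n] either [f (2n)] or [f (2n+1)] is
guessed correctly. The first puts [x n] in one column of [nat * nat] and the
second puts it on the graph of a function, both determined by [x] restricted
to [n]; a column together with a graph is a set of [ED]. Hence preimages of
predicted sets lie in [M_ideal ED], and both inequalities follow. *)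

Local Open Scope card_scope.
Local Open Scope classical_set_scope.

Definition interleave (x : nat -> nat * nat) (i : nat) : nat :=
  if odd i then (x i./2).2 else (x i./2).1.

Definition flatten_pairs (s : seq (nat * nat)) : seq nat :=
  flatten [seq [:: p.1; p.2] | p <- s].

Lemma interleave_double (x : nat -> nat * nat) (n : nat) :
  interleave x n.*2 = (x n).1.
Proof. by rewrite /interleave odd_double doubleK. Qed.

Lemma interleave_doubleS (x : nat -> nat * nat) (n : nat) :
  interleave x n.*2.+1 = (x n).2.
Proof. by rewrite /interleave /= odd_double uphalf_double. Qed.

Lemma mkseq_interleave (x : nat -> nat * nat) (n : nat) :
  mkseq (interleave x) n.*2 = flatten_pairs (mkseq x n).
Proof.
elim: n => // n IH.
rewrite doubleS !mkseqS IH interleave_double interleave_doubleS.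
by rewrite /flatten_pairs map_rcons flatten_rcons -!cats1 -catA.
Qed.

(** Serves the degenerate case where [non_M ED] is the dummy value [setT]. *)
Lemma interleave_surj (f : nat -> nat) : exists x, interleave x = f.
Proof.
exists (fun n => (f n.*2, f n.*2.+1)); apply/funext => i.
by rewrite /interleave -[in RHS](odd_double_half i); case: (odd i).
Qed.

(** The history before position 2n+1 ends with the first coordinate of the current pair, so the
    second guess is a function of [p.1]. *)
Definition guess_set (pi : predictor) (s : seq (nat * nat)) :
    set (nat * nat) :=
  [set p | p.1 = pi (flatten_pairs s) \/
           p.2 = pi (rcons (flatten_pairs s) p.1)].

Lemma ED_guess_set (pi : predictor) (s : seq (nat * nat)) :
  ED (guess_set pi s).
Proof.
(* Beyond the index of the column, a vertical section contains at most the point of the graph. *)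
exists 1; exists (pi (flatten_pairs s)).+1 => // n /= lt_n.
have sub : [set m | guess_set pi s (n, m)] `<=`
    [set pi (rcons (flatten_pairs s) n) | _ in `I_1].
  by move=> m [/= en|/= ->]; [rewrite en ltnn in lt_n | exists 0].
exact: card_le_trans (subset_card_le sub) (card_image_le _ _).
Qed.

Lemma pc_predicts_interleave (pi : predictor) (x : nat -> nat * nat) :
  pc_predicts 2 (interleave x) pi -> M_gen (guess_set pi) x.
Proof.
move=> [N _ predN]; exists N => // n /= le_Nn.
(* Starting at an even position makes the block of length 2 exactly the two coordinates of [x n]. *)
have [|j [/andP[le_j lt_j] fj]] := predN n.*2.
  by rewrite /= (leq_trans le_Nn)// -addnn leq_addr.
have [jE|jE] : j = n.*2 \/ j = n.*2.+1.
  move: le_j; rewrite leq_eqVlt => /orP[/eqP<-|gt_j]; first by left.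
  by right; apply/eqP; rewrite eqn_leq gt_j -ltnS -addn2 lt_j.
- by left; move: fj; rewrite jE interleave_double mkseq_interleave.
- right; move: fj.
  by rewrite jE interleave_doubleS mkseqS mkseq_interleave interleave_double.
Qed.

Lemma M_ideal_predicted (pi : predictor) :
  M_ideal ED [set x | pc_predicts 2 (interleave x) pi].
Proof.
move=> J [[_ Jsub _] Jgen].
apply: Jsub (@pc_predicts_interleave pi) _; apply: Jgen.
by exists (guess_set pi) => // s; exact: ED_guess_set.
Qed.

Lemma M_ideal_sub (X : Type) (I : set (set X)) (A B : set (nat -> X)) :
  A `<=` B -> M_ideal I B -> M_ideal I A.
Proof.
by move=> AB IB J JI; have [[_ Jsub _] _] := JI; exact: Jsub AB (IB J JI).
Qed.

Lemma least_size_le (T : Type) (C : set (set T)) (A : set T) :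
  C A -> least_size C #<= A.
Proof. by move=> CA; have [_] := least_sizeP (ex_intro _ A CA); exact. Qed.

Lemma e_const_le_non_M : e_const 2 #<= non_M ED.
Proof.
suff e_le : e_const 2 #<= [set interleave x | x in non_M ED].
  exact: card_le_trans e_le (card_image_le _ _).
have [neF|noF] := pselect ([set F | ~ M_ideal ED F] !=set0).
  have [/= nonP _] := least_sizeP neF.
  apply: least_size_le => pi.
  (* If [pi] predicted the interleaving of every member of [non_M ED], this set would lie in the
     ideal. *)
  apply: contra_notP nonP => noE.
  apply: M_ideal_sub (M_ideal_predicted pi) => x Fx.
  apply: contrapT => Npred; apply: noE.
  by exists (interleave x); split => //; exists x.
(* [non_M ED] is then the dummy value [setT], whose image is everything. *)
have -> : non_M ED = setT.
  by apply: xgetPN => F [FP _]; apply: noF; exists F.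
apply: subset_card_le => f _.
by have [x <-] := interleave_surj f; exists x.
Qed.

Lemma cov_M_le_v_const : cov_M ED #<= v_const 2.
Proof.
have neP : [set P : set predictor |
    forall f, exists pi, P pi /\ pc_predicts 2 f pi] !=set0.
  (* Since [mkseq f j] has size [j], the predictor [f \o size] guesses every value of [f]. *)
  exists setT => f; exists (f \o size); split => //.
  by exists 0 => // i _; exists i; rewrite /= size_mkseq leqnn addn2 leqnSn.
have [/= vP _] := least_sizeP neP.
pose G := [set [set x | pc_predicts 2 (interleave x) pi] | pi in v_const 2].
apply: (@card_le_trans _ _ _ G); last exact: card_image_le.
apply: least_size_le; split=> [_ [pi _ <-]|]; first exact: M_ideal_predicted.
rewrite -subTset => x _.
have [pi [vpi predx]] := vP (interleave x).
by exists [set y | pc_predicts 2 (interleave y) pi] => //; exists pi.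
Qed.

Theorem proposition4p20 :
  e_const 2 #<= non_M ED /\ cov_M ED #<= v_const 2.
Proof. exact: conj e_const_le_non_M cov_M_le_v_const. Qed.
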